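(* Let $T\in\mathbb{B}(\mathcal{H})$ be binormal. Then $T$ is normal if and only if $\mathcal{N}(T^{*})\subseteq\mathcal{N}(T)$ and $P_{\frac12}(T)=\Delta(T)$.
   Context: $\mathbb{B}(\mathcal{H})$ denotes the bounded linear operators on a complex Hilbert space $\mathcal{H}$; $\mathcal{N}(\cdot)$ is the null space. $T$ is binormal if $T^{*}T$ and $TT^{*}$ commute. Every $T\in\mathbb{B}(\mathcal{H})$ has a unique polar decomposition $T=U|T|$, where $|T|=(T^{*}T)^{1/2}$ and $U$ is a partial isometry with $\mathcal{N}(U)=\mathcal{N}(T)$. The Duggal transform is $T^{D}=|T|U$, the Aluthge transform is $\Delta(T)=|T|^{1/2}U|T|^{1/2}$, and for $\lambda\in[0,1]$ the power mean transform is $P_{\lambda}(T)=(1-\lambda)^2T+\lambda^2T^{D}+2\lambda(1-\lambda)\Delta(T)$. *)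

(* Defs.v *)
From HB Require Import structures.
From mathcomp Require Import all_boot all_order all_algebra complex.
From mathcomp Require Import boolp classical_sets functions reals.
From mathcomp Require Import topology normedtype.

Set Implicit Arguments.
Unset Strict Implicit.
Unset Printing Implicit Defensive.

Import Order.TTheory GRing.Theory Num.Theory.
Import numFieldNormedType.Exports.

Local Open Scope classical_set_scope.
Local Open Scope ring_scope.
Local Open Scope complex_scope.

(* The inner product is linear in its first argument and conjugate-linear in
   its second one.  Norms of vectors live in R[i] (as nonnegative reals), and
   so does the order: [0 <= z] in R[i] means that z is real and nonnegative. *)
HB.mixin Record isHilbert (R : realType) H of CompleteNormedModule R[i] H := {
  inner : {dot H for (@Num.conj R[i])} ;
  inner_normE : forall x : H, inner x x = `|x| ^+ 2
}.

#[short(type="hilbertType")]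
HB.structure Definition Hilbert (R : realType) :=
  {H of CompleteNormedModule R[i] H & isHilbert R H}.

Section Operators.
Context {R : realType} {H : hilbertType R}.
Implicit Types S T U A : H -> H.

Local Notation "'[ x , y ]" := (@inner R H x y) : ring_scope.

Definition bounded_operator T : Prop :=
  linear T /\ exists M : R, forall x, `|T x| <= M%:C * `|x|.

Definition null_space T : set H := [set x | T x = 0].

(* The adjoint, the square root and the partial isometry of the polar
   decomposition are selected by [xget] among the bounded operators with their
   defining property, which in the cases of interest is satisfied by exactly
   one operator; the default value 0 is then irrelevant. *)
Definition adjoint T : H -> H :=
  xget 0 [set S | bounded_operator S /\ forall x y, '[T x, y] = '[x, S y]].

Definition positive_operator T : Prop := forall x, 0 <= '[T x, x].

Definition sqrt_operator A : H -> H :=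
  xget 0 [set S | [/\ bounded_operator S, positive_operator S & S \o S = A]].

Definition abs_operator T : H -> H := sqrt_operator (adjoint T \o T).

Definition partial_isometry U : Prop :=
  forall x, (forall y, null_space U y -> '[x, y] = 0) -> `|U x| = `|x|.

Definition polar_isometry T : H -> H :=
  xget 0 [set U | [/\ bounded_operator U, partial_isometry U,
                      null_space U = null_space T & T = U \o abs_operator T]].

Definition duggal T : H -> H := abs_operator T \o polar_isometry T.

Definition aluthge T : H -> H :=
  sqrt_operator (abs_operator T) \o polar_isometry T
    \o sqrt_operator (abs_operator T).

Definition power_mean (l : R) T : H -> H :=
  ((1 - l) ^+ 2)%:C *: T + (l ^+ 2)%:C *: duggal T
    + (2 * l * (1 - l))%:C *: aluthge T.

Definition normal_operator T : Prop := adjoint T \o T = T \o adjoint T.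

Definition binormal_operator T : Prop :=
  (adjoint T \o T) \o (T \o adjoint T) = (T \o adjoint T) \o (adjoint T \o T).

End Operators.

(* Main.v *)
(* Write M = |T|, A = |T|^(1/2), T = U M and B = U A U^*.

   If T is normal, then T commutes with M^2 = T^*T, hence with M; so U commutes
   with M, hence with A, and T, T^D and Delta(T) all coincide.

   Conversely, P_(1/2)(T) = Delta(T) says U A^2 + A^2 U = 2 A U A.  Always
   A U^*U = A, and N(T^* ) <= N(T) gives A U U^* = A; multiplying by U^* on the
   right yields A^2 + B^2 = 2 A B.  The quadratic form of this identity is
   |A x|^2 + |B x|^2 = 2 Re <A x, B x>, so A = B and
   T^*T = A^4 = B^4 = T T^*.

   The adjoint, the square root and the polar isometry are only known through
   [xget], so their existence has to be established. *)
Require Import Defs.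
From mathcomp Require Import all_boot all_order all_algebra complex.
From mathcomp Require Import boolp classical_sets functions reals.
From mathcomp Require Import topology normedtype.
From mathcomp Require Import ring lra.

Set Implicit Arguments.
Unset Strict Implicit.
Unset Printing Implicit Defensive.

Import Order.TTheory GRing.Theory Num.Theory.
Import numFieldNormedType.Exports.

Local Open Scope classical_set_scope.
Local Open Scope ring_scope.
Local Open Scope complex_scope.

(** * The underlying real inner product *)

Section RealInnerProduct.
Context {R : realType} {H : hilbertType R}.
Implicit Types (x y z : H) (a : R).

Local Notation "'[ x , y ]" := (@inner R H x y) : ring_scope.

(** The real part makes H a real Hilbert space, so that estimates become inequalities in R;
    [Im_inner] recovers the imaginary part. *)
Definition rdot x y : R := complex.Re '[x, y].
Definition nrm x : R := complex.Re `|x|.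

Lemma nrmE x : `|x| = (nrm x)%:C.
Proof. by rewrite /nrm RRe_real ?normr_real. Qed.

Lemma nrm_ge0 x : 0 <= nrm x.
Proof. by rewrite -lecR -nrmE; exact: normr_ge0. Qed.

Lemma nrm_le x y (M : R) : (`|x| <= M%:C * `|y|) = (nrm x <= M * nrm y).
Proof. by rewrite !nrmE -rmorphM lecR. Qed.

Lemma nrmD x y : nrm (x + y) <= nrm x + nrm y.
Proof. by have := ler_normD x y; rewrite !nrmE -rmorphD lecR. Qed.

Lemma nrmN x : nrm (- x) = nrm x.
Proof. by rewrite /nrm normrN. Qed.

Lemma nrmB x y : nrm (x - y) = nrm (y - x).
Proof. by rewrite -nrmN opprB. Qed.

Lemma nrm_triangle y x z : nrm (x - z) <= nrm (x - y) + nrm (y - z).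
Proof. by have := nrmD (x - y) (y - z); rewrite addrA subrK. Qed.

Lemma nrm0 : nrm (0 : H) = 0.
Proof. by rewrite /nrm normr0. Qed.

Lemma nrm_eq0 x : nrm x = 0 -> x = 0.
Proof. by move=> x0; apply/normr0_eq0; rewrite nrmE x0. Qed.

Lemma nrmZ (c : R[i]) x : nrm (c *: x) = complex.Re `|c| * nrm x.
Proof.
rewrite /nrm normrZ -/(nrm x) nrmE.
have -> : `|c| = (complex.Re `|c|)%:C by rewrite RRe_real ?normr_real.
by rewrite -rmorphM.
Qed.

Lemma nrmZr a x : 0 <= a -> nrm (a%:C *: x) = a * nrm x.
Proof. by move=> a0; rewrite nrmZ ger0_norm ?ler0c. Qed.

Lemma ReD (c d : R[i]) : complex.Re (c + d) = complex.Re c + complex.Re d.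
Proof. by case: c d => [? ?] []. Qed.

Lemma ReN (c : R[i]) : complex.Re (- c) = - complex.Re c.
Proof. by case: c. Qed.

Lemma ReMr (a : R) (c : R[i]) : complex.Re (a%:C * c) = a * complex.Re c.
Proof. by case: c => u v /=; rewrite mul0r subr0. Qed.

Lemma ReJ (c : R[i]) : complex.Re c^* = complex.Re c.
Proof. by case: c. Qed.

Lemma ImJ (c : R[i]) : complex.Im c^* = - complex.Im c.
Proof. by case: c. Qed.

Lemma Im_ReM (c : R[i]) : complex.Im c = complex.Re (- 'i * c).
Proof. by case: c => u v /=; rewrite oppr0 mul0r sub0r mulN1r opprK. Qed.

Lemma rdotDl x y z : rdot (x + y) z = rdot x z + rdot y z.
Proof. by rewrite /rdot linearDl; exact: ReD. Qed.

Lemma rdotNl x y : rdot (- x) y = - rdot x y.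
Proof. by rewrite /rdot linearNl; exact: ReN. Qed.

Lemma rdotC x y : rdot x y = rdot y x.
Proof. by rewrite /rdot hermC/= expr0 mul1r; exact: ReJ. Qed.

Lemma rdotBl x y z : rdot (x - y) z = rdot x z - rdot y z.
Proof. by rewrite rdotDl rdotNl. Qed.

Lemma rdotDr x y z : rdot z (x + y) = rdot z x + rdot z y.
Proof. by rewrite rdotC rdotDl !(rdotC z). Qed.

Lemma rdotNr x y : rdot x (- y) = - rdot x y.
Proof. by rewrite rdotC rdotNl rdotC. Qed.

Lemma rdotBr x y z : rdot z (x - y) = rdot z x - rdot z y.
Proof. by rewrite rdotDr rdotNr. Qed.

Lemma rdot0l x : rdot 0 x = 0.
Proof. by rewrite /rdot linear0l. Qed.

Lemma rdotZl a x y : rdot (a%:C *: x) y = a * rdot x y.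
Proof. by rewrite /rdot linearZl_LR; exact: ReMr. Qed.

Lemma rdotZr a x y : rdot x (a%:C *: y) = a * rdot x y.
Proof. by rewrite rdotC rdotZl rdotC. Qed.

Lemma rdot_conj (c : R[i]) x y : rdot (c *: x) y = rdot x (c^* *: y).
Proof. by rewrite -[in LHS](conjcK c) /rdot linearZl_LR linearZr_LR. Qed.

Lemma Im_inner x y : complex.Im '[x, y] = rdot (- 'i *: x) y.
Proof. by rewrite Im_ReM /rdot linearZl_LR. Qed.

Lemma rdot_nrm x : rdot x x = nrm x ^+ 2.
Proof.
by rewrite /rdot inner_normE nrmE expr2/= mulr0 subr0 -expr2.
Qed.

Lemma rdotT_eq0 x : (forall y, rdot x y = 0) -> x = 0.
Proof.
by move=> /(_ x)/eqP; rewrite rdot_nrm sqrf_eq0 => /eqP; exact: nrm_eq0.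
Qed.

Lemma nrm_sqrD x y : nrm (x + y) ^+ 2 = nrm x ^+ 2 + nrm y ^+ 2 + 2 * rdot x y.
Proof. by rewrite -!rdot_nrm !(rdotDl, rdotDr) (rdotC y x); ring. Qed.

Lemma nrm_sqrB x y : nrm (x - y) ^+ 2 = nrm x ^+ 2 + nrm y ^+ 2 - 2 * rdot x y.
Proof. by rewrite nrm_sqrD nrmN rdotNr; ring. Qed.

Lemma quad_ge0 (p q r : R) :
  (forall t, 0 <= p + 2 * t * q + t ^+ 2 * r) -> 0 <= r -> q ^+ 2 <= p * r.
Proof.
move=> h r0; have [r_gt0|] := ltP 0 r.
  have := h (- q / r).
  have -> : p + 2 * (- q / r) * q + (- q / r) ^+ 2 * r = (p * r - q ^+ 2) / r.
    by field; rewrite gt_eqF.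
  by rewrite pmulr_lge0 ?invr_gt0// subr_ge0.
move=> r_le0; have r_eq0 : r = 0 by apply/eqP; rewrite eq_le r_le0 r0.
suff -> : q = 0 by rewrite r_eq0 mulr0 expr0n.
apply/eqP/negPn/negP => q0.
(* With r = 0 the polynomial is affine in t; for q <> 0 this t gives it the value -1. *)
have := h (- (p + 1) / (2 * q)).
have -> : p + 2 * (- (p + 1) / (2 * q)) * q + (- (p + 1) / (2 * q)) ^+ 2 * r
  = - 1 by rewrite r_eq0; field.
by rewrite oppr_ge0 ler10.
Qed.

Lemma rdot_le x y : rdot x y <= nrm x * nrm y.
Proof.
suff h : rdot x y ^+ 2 <= (nrm x * nrm y) ^+ 2.
  have xy0 : 0 <= nrm x * nrm y by rewrite mulr_ge0 ?nrm_ge0.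
  rewrite leNgt; apply/negP => lt_xy; move: h; rewrite leNgt.
  by rewrite ltr_sqr ?lt_xy ?nnegrE// (le_trans xy0) ?ltW.
rewrite exprMn; apply: quad_ge0; rewrite ?sqr_ge0// => t.
have := sqr_ge0 (nrm (x + t%:C *: y)).
by rewrite -!rdot_nrm !(rdotDl, rdotDr, rdotZl, rdotZr) (rdotC y x); nra.
Qed.

(** Absorbs a constant factor in front of epsilon, so that limit arguments can add up errors without
    rescaling them. *)
Lemma le_eps (K u v : R) : 0 <= K ->
  (forall e : R, 0 < e -> u <= v + K * e) -> u <= v.
Proof.
move=> K0 h; apply/ler_addgt0Pr => e e0.
have K1 : 0 < K + 1 by rewrite ltr_wpDl.
apply: le_trans (h (e / (K + 1)) _) _; first exact: divr_gt0.
by rewrite lerD2l mulrA ler_pdivrMr// mulrC ler_pM2l// lerDl.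
Qed.

Lemma nrm_le_eps (K : R) x : 0 <= K ->
  (forall e : R, 0 < e -> nrm x <= K * e) -> x = 0.
Proof.
move=> K0 h; apply: nrm_eq0; apply/eqP; rewrite eq_le nrm_ge0 andbT.
by apply: (le_eps K0) => e /h; rewrite add0r.
Qed.

(** Completeness without sequences: think of [F e] as the set of approximate solutions with error at
    most e. These sets generate a Cauchy filter, and its limit is approached by members of each
    [F e]. *)
Lemma shrinking_limit (F : R -> set H) :
  (forall e e' : R, e <= e' -> F e `<=` F e') ->
  (forall e : R, 0 < e -> F e !=set0) ->
  (forall e : R, 0 < e -> exists2 d, 0 < d &
     forall u v, F d u -> F d v -> nrm (u - v) <= e) ->
  exists p, forall e : R, 0 < e -> exists2 u, F e u & nrm (u - p) <= e.
Proof.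
move=> Fmono Fne Fsmall.
pose G : set_system H := [set A | exists2 d, 0 < d & F d `<=` A].
have FG : ProperFilter G.
  split; first by move=> [d /Fne[u Fu] /(_ u Fu)].
  split.
  - by exists 1.
  - move=> P Q [d d0 dP] [e e0 eQ]; exists (Num.min d e).
      by rewrite lt_min d0 e0.
    by move=> u Fu; split; [apply: dP|apply: eQ];
      apply: Fmono Fu; rewrite ge_min lexx ?orbT.
  - by move=> P Q PQ [d d0 dP]; exists d => // u /dP/PQ.
have : cauchy G.
  apply: cauchy_exP => e e0.
  have eE : e = (complex.Re e)%:C by rewrite RRe_real// gtr0_real.
  have e'0 : 0 < complex.Re e by rewrite -ltcR -eE.
  have [d d0 hd] := Fsmall (complex.Re e / 2) (divr_gt0 e'0 (ltr0n _ 2)).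
  have [u Fu] := Fne _ d0.
  exists u; exists d => // v Fv.
  rewrite -ball_normE/= nrmE eE ltcR (le_lt_trans (hd _ _ Fu Fv))//.
  by rewrite ltr_pdivrMr// ltr_pMr// ltr1n.
move=> /cauchy_cvg/(cvg_ex _)[/= p Gp]; exists p => e e0.
have [|d d0 hd] := Gp (ball p e%:C).
  by apply: nbhsx_ballx; rewrite ltcR.
(* Below d the point is close to p; below e it belongs to [F e]. *)
have [|u Fu] := Fne (Num.min d e); first by rewrite lt_min d0 e0.
exists u; first by apply: Fmono Fu; rewrite ge_min lexx orbT.
have : ball p e%:C u by apply: hd; apply: Fmono Fu; rewrite ge_min lexx.
by rewrite -ball_normE/= nrmE ltcR nrmB => /ltW.
Qed.

End RealInnerProduct.

(** * Orthogonal projections and adjoints *)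

Section Projection.
Context {R : realType} {H : hilbertType R}.
Implicit Types (x y z : H) (a : R).

(** By the parallelogram law, near-minimisers of the distance from x to V are close to each other;
    their limit p is the nearest point. Since V need not be closed, p is only known to lie in its
    closure. *)
Lemma orth_projection (V : set H) x :
  V 0 -> (forall u v, V u -> V v -> V (u + v)) ->
  (forall a u, V u -> V (a%:C *: u)) ->
  exists2 p, (forall e : R, 0 < e -> exists2 v, V v & nrm (p - v) <= e) &
    forall v, V v -> rdot (x - p) v = 0.
Proof.
move=> V0 VD VZ; pose E := [set nrm (x - v) | v in V]; pose D := inf E.
have E0 : E !=set0 by exists (nrm (x - 0)), 0.
have Elb : has_lbound E by exists 0 => _ [v _ <-]; exact: nrm_ge0.
have Dle v : V v -> D <= nrm (x - v).
  by move=> Vv; apply: ge_inf => //; exists v.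
have D0 : 0 <= D by apply: lb_le_inf => // _ [v _ <-]; exact: nrm_ge0.
pose F e := [set v | V v /\ nrm (x - v) <= D + e].
have [e e' ee' v [Vv le_v]|e e0|e e0|p hp] := @shrinking_limit _ _ F.
- by split=> //; rewrite (le_trans le_v)// lerD2l.
- have [_ [v Vv <-] lt_v] := inf_adherent e0 (conj E0 Elb).
  by exists v; split=> //; exact: ltW.
(* The parallelogram law will give |u - v|^2 <= 4 (D + d)^2 - 4 D^2 = d (8 D + 4 d), and d <= 1. *)
- pose d := Num.min 1 (e ^+ 2 / (8 * D + 4)).
  have D4 : 0 < 8 * D + 4 by lra.
  have d0 : 0 < d by rewrite lt_min ltr01 divr_gt0 ?exprn_gt0.
  have d1 : d <= 1 by rewrite ge_min lexx.
  have de : d * (8 * D + 4) <= e ^+ 2.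
    by rewrite -ler_pdivlMr// ge_min lexx orbT.
  exists d => // u v [Vu le_u] [Vv le_v].
  have Vm : V ((2^-1)%:C *: (u + v)) by apply/VZ/VD.
  have := Dle _ Vm; set m := _ *: _ => le_m.
  have para : nrm (u - v) ^+ 2 =
      2 * nrm (x - u) ^+ 2 + 2 * nrm (x - v) ^+ 2 - 4 * nrm (x - m) ^+ 2.
    rewrite -!rdot_nrm /m !(rdotBl, rdotBr, rdotDl, rdotDr, rdotZl, rdotZr).
    by rewrite (rdotC u x) (rdotC v x) (rdotC v u); field.
  have : nrm (u - v) ^+ 2 <= e ^+ 2.
    by rewrite para; have := nrm_ge0 (x - u); have := nrm_ge0 (x - v); nra.
  by rewrite ler_sqr ?nnegrE ?nrm_ge0// ltW.
exists p => [e /hp[v [Vv _] le_v]|v Vv]; first by exists v; rewrite 1?nrmB.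
(* The factor 3 counts the uses of |u - p| <= e and of |x - u| <= D + e, where u in V approximates
   p. *)
have pmin w : V w -> nrm (x - p) <= nrm (x - p - w).
  move=> Vw; apply: (@le_eps _ 3) => [//|e e0].
  have [u [Vu le_u] le_up] := hp e e0.
  have := Dle _ (VD _ _ Vu Vw).
  have := nrm_triangle u x p; have := nrm_triangle (p + w) x (u + w).
  have -> : p + w - (u + w) = p - u by rewrite opprD addrACA subrr addr0.
  by rewrite (nrmB p) -addrA -opprD; lra.
apply/eqP; rewrite -sqrf_eq0 eq_le sqr_ge0 andbT.
(* Minimality at p - t v is the nonnegativity of a quadratic in t with constant term 0, so its
   linear coefficient vanishes. *)
rewrite -[leRHS](mul0r (nrm v ^+ 2)); apply: quad_ge0; rewrite ?sqr_ge0// => t.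
have := pmin _ (VZ (- t) _ Vv).
rewrite -ler_sqr ?nnegrE ?nrm_ge0// (nrm_sqrB (x - p)) -(rdot_nrm (_ *: v)).
by rewrite !(rdotZl, rdotZr) rdot_nrm; nra.
Qed.

(** If f x <> 0 and p is the projection of x on the kernel of f, then x - p spans the orthogonal
    complement of the kernel, and w is a multiple of it. The one-sided bound controls |f| through u
    |-> - u. *)
Lemma riesz (f : H -> R) (C : R) :
  (forall u v, f (u + v) = f u + f v) ->
  (forall a u, f (a%:C *: u) = a * f u) ->
  (forall u, f u <= C * nrm u) ->
  exists w, forall x, f x = rdot x w.
Proof.
move=> fD fZ fC.
have f0 : f 0 = 0 by rewrite -(scale0r 0) fZ mul0r.
have fB u v : f (u - v) = f u - f v.
  by rewrite fD -scaleN1r -(rmorphN1 (@real_complex R)) fZ mulN1r.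
have [f_eq0|] := pselect (forall x, f x = 0).
  by exists 0 => x; rewrite f_eq0 rdotC rdot0l.
move=> /existsNP[x /eqP fx0].
have [//|u v fu fv|a u fu|p cl_p orth] := @orth_projection [set v | f v = 0] x.
- by rewrite /= fD fu fv addr0.
- by rewrite /= fZ fu mulr0.
have fabs u : `|f u| <= `|C| * nrm u.
  have le_f v : f v <= `|C| * nrm v.
    by rewrite (le_trans (fC v))// ler_wpM2r ?nrm_ge0// ler_norm.
  by rewrite ler_norml le_f lerNl -[- f u]sub0r -f0 -fB sub0r -(nrmN u) le_f.
have fp0 : f p = 0.
  apply/eqP; rewrite -normr_le0; apply: (@le_eps _ `|C|) => // e e0.
  have [v /= fv le_pv] := cl_p _ e0; rewrite add0r -[f p]subr0 -fv -fB.
  by rewrite (le_trans (fabs _))// ler_wpM2l.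
have fxp : f (x - p) = f x by rewrite fB fp0 subr0.
have w0 : nrm (x - p) != 0.
  apply/eqP => /nrm_eq0 xp0.
  by move: fx0; rewrite -fxp xp0 f0 eqxx.
exists ((f x / nrm (x - p) ^+ 2)%:C *: (x - p)) => y; rewrite rdotZr.
have := orth (y - (f y / f x)%:C *: (x - p)).
rewrite /= fB fZ fxp divfK ?fx0// subrr rdotBr rdotZr rdot_nrm => /(_ erefl).
by move=> /eqP; rewrite subr_eq0 rdotC => /eqP ->; field; rewrite w0 fx0.
Qed.

End Projection.

(** * Bounded operators, adjoints and positivity *)

Section BoundedOperators.
Context {R : realType} {H : hilbertType R}.
Implicit Types (x y z : H) (a : R) (S T U : H -> H).

Lemma bounded_operatorE T :
  bounded_operator T <->
  linear T /\ exists2 M : R, 0 < M & forall x, nrm (T x) <= M * nrm x.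
Proof.
split=> [[Tl [M hM]]|[Tl [M _ hM]]]; split=> //.
  exists (`|M| + 1) => [|x]; first by rewrite ltr_wpDl.
  have := hM x; rewrite nrm_le => /le_trans; apply.
  by rewrite ler_wpM2r ?nrm_ge0// (le_trans (ler_norm M))// lerDl.
by exists M => x; rewrite nrm_le.
Qed.

Section Linear.
Variables (T : H -> H) (Tlin : linear T).

Lemma opD x y : T (x + y) = T x + T y.
Proof. by have := Tlin 1 x y; rewrite !scale1r. Qed.

Lemma op0 : T 0 = 0.
Proof. by apply: (addrI (T 0)); rewrite -opD !addr0. Qed.

Lemma opZ (c : R[i]) x : T (c *: x) = c *: T x.
Proof. by have := Tlin c x 0; rewrite op0 !addr0. Qed.

Lemma opN x : T (- x) = - T x.
Proof. by rewrite -scaleN1r opZ scaleN1r. Qed.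

Lemma opB x y : T (x - y) = T x - T y.
Proof. by rewrite opD opN. Qed.

End Linear.

(** Adjointness tested on real parts only; for linear S, [adjoint_pair_inner] upgrades it to the
    complex inner product. *)
Definition adjoint_pair S T := forall x y, rdot (S x) y = rdot x (T y).

Lemma adjoint_pair_inner S T : linear S -> adjoint_pair S T ->
  forall x y, inner (S x) y = inner x (T y).
Proof.
move=> Sl ST x y; apply/eqP; rewrite eq_complex; apply/andP; split; apply/eqP.
  exact: ST.
by rewrite !Im_inner -opZ// ST.
Qed.

Lemma adjoint_pair_sym S T : adjoint_pair S T -> adjoint_pair T S.
Proof. by move=> ST x y; rewrite rdotC -ST rdotC. Qed.

Lemma adjoint_pair_linear S T : linear S -> adjoint_pair S T -> linear T.
Proof.
move=> Sl ST c x y; apply/eqP; rewrite -subr_eq0; apply/eqP/rdotT_eq0 => z.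
rewrite rdotC rdotBr -ST !rdotDr -(conjcK c) -!rdot_conj -!ST opZ//.
by rewrite !rdot_conj subrr.
Qed.

Lemma adjoint_pair_bounded S T :
  bounded_operator S -> adjoint_pair S T -> bounded_operator T.
Proof.
move=> /bounded_operatorE[Sl [M M0 hM]] ST; apply/bounded_operatorE; split.
  exact: adjoint_pair_linear ST.
exists M => // y; have [->|Ty0] := eqVneq (nrm (T y)) 0.
  by rewrite mulr_ge0 ?nrm_ge0// ltW.
have Ty_gt0 : 0 < nrm (T y) by rewrite lt_def Ty0 nrm_ge0.
rewrite -(ler_pM2l Ty_gt0) -expr2 -rdot_nrm -ST (le_trans (rdot_le _ _))//.
by rewrite mulrCA mulrA ler_wpM2r ?nrm_ge0.
Qed.

Lemma adjoint_pair_exists S :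
  bounded_operator S -> exists T, adjoint_pair S T.
Proof.
move=> /bounded_operatorE[Sl [M M0 hM]].
have /choice[T hT] y : exists w, forall x, rdot (S x) y = rdot x w.
  apply: (@riesz _ _ _ (M * nrm y)) => [u v|a u|u].
  - by rewrite opD// rdotDl.
  - by rewrite opZ// rdotZl.
  by rewrite (le_trans (rdot_le _ _))// mulrAC ler_wpM2r ?nrm_ge0.
by exists T => x y; exact: hT.
Qed.

Lemma adjointP S : bounded_operator S -> adjoint_pair S (adjoint S).
Proof.
move=> Sb; have [T ST] := adjoint_pair_exists Sb.
rewrite /adjoint; case: xgetP => [T' _ [_ hT'] x y|/(_ T)].
  by rewrite /rdot hT'.
case; split; first exact: adjoint_pair_bounded ST.
by apply: adjoint_pair_inner => //; case: Sb.
Qed.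

(** Polarisation: positivity includes that the quadratic form of S is real, and this is applied to
    the vector i x + y, where only the cross terms survive. *)
Lemma positive_adjoint_pair S :
  linear S -> positive_operator S -> adjoint_pair S S.
Proof.
move=> Sl Spos x y; rewrite (rdotC x).
have im0 z : complex.Im (inner (S z) z) = 0.
  by have := Spos z; rewrite lecE => /andP[/eqP].
have rdot_i z w : rdot z ('i *: w) = - rdot ('i *: z) w.
  by rewrite rdot_conj -rdotNr -scaleNr; congr rdot; congr (_ *: _);
    apply/eqP; rewrite eq_complex/= oppr0 opprK !eqxx.
have rdotSi z : rdot ('i *: S z) z = 0.
  by have := im0 z; rewrite Im_inner scaleNr rdotNl => /eqP;
    rewrite oppr_eq0 => /eqP.
have := rdotSi ('i *: x + y).
rewrite opD// opZ// scalerDr !(rdotDl, rdotDr) rdotSi addr0 !rdot_i scalerA.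
rewrite -expr2 sqr_i scaleN1r.
rewrite !scalerA -expr2 sqr_i !scaleN1r !rdotNl rdotSi !oppr0 add0r opprK.
by move=> /eqP; rewrite addrC subr_eq0 => /eqP.
Qed.

Lemma rdot_positive S : positive_operator S -> forall x, 0 <= rdot (S x) x.
Proof. by move=> Spos x; have := Spos x; rewrite lecE => /andP[_]. Qed.

(** Self-adjointness makes <S x, x> equal to its own conjugate, so only its real part has to be
    examined. *)
Lemma positive_of_rdot S : linear S -> adjoint_pair S S ->
  (forall x, 0 <= rdot (S x) x) -> positive_operator S.
Proof.
move=> Sl SS pos x; rewrite lecE/=; apply/andP; split; last exact: pos.
have /eqP : complex.Im (inner (S x) x) = - complex.Im (inner (S x) x).
  rewrite {1}(adjoint_pair_inner Sl SS) {1}hermC/= expr0 mul1r.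
  exact: ImJ.
by rewrite -addr_eq0 -mulr2n mulrn_eq0.
Qed.

End BoundedOperators.

(** * Square roots of positive operators *)

Section SquareRoot.
Context {R : realType} {H : hilbertType R}.
Implicit Types (x y z : H) (a : R) (S T U : H -> H).

(** Positivity of S at M x - S x, together with |S| <= M, gives |S x|^2 <= M (S x, x); expanding |M
    x - S x|^2 then gives the bound. *)
Lemma positive_shift S (M : R) : linear S -> adjoint_pair S S ->
  (forall x, 0 <= rdot (S x) x) -> 0 < M ->
  (forall x, nrm (S x) <= M * nrm x) ->
  forall x, nrm (M%:C *: x - S x) <= M * nrm x.
Proof.
move=> Sl SS pos M0 hM x.
have := pos (M%:C *: x - S x).
rewrite opB// opZ// !(rdotBl, rdotBr, rdotZl, rdotZr) (SS (S x) x).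
have := rdot_le (S (S x)) (S x) => r_le.
have := hM (S x); have := nrm_ge0 (S x) => q0 r_le'.
have {}r_le : rdot (S (S x)) (S x) <= M * nrm (S x) ^+ 2.
  by rewrite (le_trans r_le)// expr2 mulrA ler_wpM2r.
rewrite !rdot_nrm => h.
have le_q : nrm (S x) ^+ 2 <= M * rdot (S x) x.
  by rewrite -(ler_pM2l M0); lra.
rewrite -ler_sqr ?nnegrE ?mulr_ge0 ?nrm_ge0 ?(ltW M0)//.
rewrite nrm_sqrB nrmZr ?(ltW M0)// rdotZl (rdotC x).
have := mulr_ge0 (ltW M0) (pos x); lra.
Qed.

Section Contraction.
Variables (P : H -> H) (Plin : linear P) (Padj : adjoint_pair P P).
Hypothesis Ppos : forall x, 0 <= rdot (P x) x.
Hypothesis Pcontr : forall x, nrm (P x) <= nrm x.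

(* Iterates of [Z |-> (1 - P + Z^2) / 2]; a fixed point gives [(1 - Z)^2 = P].
   The scalar iterates for [P = 0] dominate their increments in norm. *)
Fixpoint sqrt_iter n x : H :=
  if n is m.+1 then (2^-1)%:C *: (x - P x + sqrt_iter m (sqrt_iter m x)) else 0.

Fixpoint sqrt_bound n : R :=
  if n is m.+1 then (1 + sqrt_bound m ^+ 2) / 2 else 0.

Let Y := sqrt_iter.
Let b := sqrt_bound.

Lemma sqrt_bound01 n : 0 <= b n <= 1.
Proof.
elim: n => [|n /andP[b0 b1]]; first by rewrite lexx ler01.
by rewrite /b/= -/(b n); apply/andP; split; nra.
Qed.

Lemma sqrt_boundS n : b n <= b n.+1.
Proof. by rewrite /b/= -/(b n); have := sqr_ge0 (1 - b n); nra. Qed.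

Lemma sqrt_iter_lin n : linear (Y n).
Proof.
elim: n => [|n IH] c x y; first by rewrite /Y/= scaler0 addr0.
rewrite /Y/= -/(Y n) Plin !(opD IH) !(opZ IH) scalerA mulrC -scalerA -scalerDr.
by congr (_ *: _); rewrite !scalerDr scalerN opprD [in RHS]addrACA; congr (_ + _);
  rewrite addrACA.
Qed.

Lemma sqrt_iter_adj n : adjoint_pair (Y n) (Y n).
Proof.
elim: n => [|n IH] x y; first by rewrite /Y/= rdot0l rdotC rdot0l.
by rewrite /Y/= -/(Y n) rdotZl rdotZr !(rdotDl, rdotDr, rdotNl, rdotNr) Padj !IH.
Qed.

Lemma sqrt_iter_nrm n x : nrm (Y n x) <= b n * nrm x.
Proof.
elim: n x => [|n IH] x; first by rewrite /Y/= nrm0 mul0r.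
have /andP[b0 _] := sqrt_bound01 n.
have hB : nrm (x - P x) <= nrm x.
  rewrite -[nrm x]mul1r -[x in x - _]scale1r.
  by apply: positive_shift => // y; rewrite mul1r.
rewrite /Y/b/= -/(Y n) -/(b n) nrmZr ?invr_ge0// mulrAC mulrC.
rewrite ler_wpM2r ?invr_ge0// (le_trans (nrmD _ _))// mulrDl mul1r lerD//.
by rewrite (le_trans (IH _))// expr2 -mulrA ler_wpM2l.
Qed.

Lemma sqrt_iterS n x : nrm (Y n.+1 x - Y n x) <= (b n.+1 - b n) * nrm x.
Proof.
elim: n x => [|n IH] x.
  by have := sqrt_iter_nrm 1 x; rewrite /Y/b/= !subr0.
have /andP[b0 _] := sqrt_bound01 n; have /andP[b0' _] := sqrt_bound01 n.+1.
(* A difference of squares, split as V (V - W) + (V - W) W, which is valid for noncommuting V and W;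
   the scalar bounds are split in the same way below. *)
have -> : Y n.+2 x - Y n.+1 x = (2^-1)%:C *:
   (Y n.+1 (Y n.+1 x - Y n x) + (Y n.+1 (Y n x) - Y n (Y n x))).
  rewrite (opB (sqrt_iter_lin _)) addrA subrK.
  rewrite [LHS](_ : _ = (2^-1)%:C *: (x - P x + Y n.+1 (Y n.+1 x)) -
    (2^-1)%:C *: (x - P x + Y n (Y n x)))// -scalerBr.
  by rewrite opprD addrACA subrr add0r.
have -> : b n.+2 - b n.+1 =
    2^-1 * (b n.+1 * (b n.+1 - b n) + (b n.+1 - b n) * b n).
  by rewrite [b n.+2]/b/= -/(b n.+1) [in X in _ - X]/b/= -/(b n); field.
rewrite nrmZr ?invr_ge0// -mulrA ler_wpM2l ?invr_ge0// (le_trans (nrmD _ _))//.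
rewrite mulrDl lerD//.
  by rewrite (le_trans (sqrt_iter_nrm _ _))// -mulrA ler_wpM2l.
by rewrite (le_trans (IH _))// -mulrA ler_wpM2l ?subr_ge0 ?sqrt_boundS ?sqrt_iter_nrm.
Qed.

Lemma sqrt_iter_cauchy m n x : (m <= n)%N ->
  nrm (Y n x - Y m x) <= (b n - b m) * nrm x.
Proof.
move=> /subnK <-; elim: (n - m)%N => [|k IH].
  by rewrite add0n !subrr nrm0 mul0r.
rewrite addSn (le_trans (nrm_triangle (Y (k + m) x) _ _))//.
have := sqrt_iterS (k + m) x; have := IH; rewrite !mulrBl; lra.
Qed.

(** The scalar bounds increase and stay below 1, so their supremum s gives the rate (s - b_n) |x|,
    uniform in the direction of x. Both Y_n and Y_(n+1) are controlled by one n because the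
    fixed-point equation involves both. *)
Lemma sqrt_iter_limit : exists Z : H -> H, forall e : R, 0 < e ->
  exists n, forall x, nrm (Y n x - Z x) <= e * nrm x /\
                      nrm (Y n.+1 x - Z x) <= e * nrm x.
Proof.
pose s := sup (range b).
have bub : has_ubound (range b).
  by exists 1 => _ [n _ <-]; have /andP[] := sqrt_bound01 n.
have bsup : has_sup (range b) by split => //; exists (b 0), 0%N.
have bs n : b n <= s by apply: sup_ubound => //; exists n.
have bnear e : 0 < e -> exists n, s - b n <= e.
  by move=> e0; have [_ [n _ <-] lt_n] := sup_adherent e0 bsup; exists n;
    rewrite lerBlDr -lerBlDl ltW.
have /choice[Z hZ] x : exists z, forall n, nrm (Y n x - z) <= (s - b n) * nrm x.
  pose F e := [set u | exists2 n, s - b n <= e & u = Y n x].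
  have [e e' ee' _ [n le_n ->]|e e0|e e0|z hz] := @shrinking_limit _ _ F.
  - by exists n => //; rewrite (le_trans le_n).
  - by have [n le_n] := bnear e e0; exists (Y n x), n.
  (* Adding 1 keeps the denominator positive when x = 0. *)
  - have x1 : 0 < nrm x + 1 by rewrite ltr_wpDl ?nrm_ge0.
    exists (e / (nrm x + 1)) => [|_ _ [m le_m ->] [n le_n ->]].
      exact: divr_gt0.
    have de : e / (nrm x + 1) * nrm x <= e.
      by rewrite mulrAC ler_pdivrMr// ler_pM2l// lerDl.
    have key k l : (k <= l)%N -> s - b k <= e / (nrm x + 1) ->
        nrm (Y l x - Y k x) <= e.
      move=> kl le_k; rewrite (le_trans (sqrt_iter_cauchy x kl))//.
      rewrite (le_trans _ de)// ler_wpM2r ?nrm_ge0//.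
      by have := bs l; lra.
    by case/orP: (leq_total m n) => [mn|nm]; [rewrite nrmB|]; apply: key.
  exists z => n; apply: (@le_eps _ (nrm x + 1)) => [|e e0].
    by rewrite addr_ge0 ?nrm_ge0.
  have [_ [m le_m ->] le_z] := hz e e0.
  apply: le_trans (nrm_triangle (Y m x) _ _) _.
  have le_mn : nrm (Y n x - Y m x) <= (s - b n) * nrm x + e * nrm x.
    have x0 := nrm_ge0 x; have [bm bn] := (bs m, bs n).
    case/orP: (leq_total m n) => [mn|nm].
      by have := sqrt_iter_cauchy x mn; nra.
    by rewrite nrmB; have := sqrt_iter_cauchy x nm; nra.
  by apply: (le_trans (lerD le_mn le_z)); lra.
exists Z => e e0; have [n le_n] := bnear e e0; exists n => x; split.
  by rewrite (le_trans (hZ x n))// ler_wpM2r ?nrm_ge0.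
rewrite (le_trans (hZ x n.+1))// ler_wpM2r ?nrm_ge0//.
by have := sqrt_boundS n; lra.
Qed.

(** The root is 1 - Z, with Z the limit of the iterates; it is positive by Cauchy-Schwarz, since Z
    is a self-adjoint contraction. *)
Lemma contraction_sqrt : exists S,
  [/\ bounded_operator S, positive_operator S & S \o S = P].
Proof.
have [Z hZ] := sqrt_iter_limit.
have Zlin : linear Z.
  move=> c x y; apply/eqP; rewrite -subr_eq0; apply/eqP.
  apply: (@nrm_le_eps _ _ (nrm (c *: x + y) + nrm (c *: x) + nrm y)) => [|e e0].
    by rewrite !addr_ge0 ?nrm_ge0.
  have [n hn] := hZ e e0; have [h1 _] := hn (c *: x + y).
  have [h2 _] := hn x; have [h3 _] := hn y.
  have {}h2 : nrm (c *: Y n x - c *: Z x) <= e * nrm (c *: x).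
    rewrite -scalerBr !nrmZ mulrCA ler_wpM2l//.
    by rewrite -ler0c RRe_real ?normr_real ?normr_ge0.
  apply: le_trans (nrm_triangle (Y n (c *: x + y)) _ _) _.
  have h4 : nrm (Y n (c *: x + y) - (c *: Z x + Z y)) <=
      nrm (c *: Y n x - c *: Z x) + nrm (Y n y - Z y).
    by rewrite sqrt_iter_lin opprD addrACA nrmD.
  by rewrite (nrmB (Z _)); lra.
have Zadj : adjoint_pair Z Z.
  have le_adj x y : rdot (Z x) y <= rdot x (Z y).
    apply: (@le_eps _ (2 * nrm x * nrm y)) => [|e e0].
      by rewrite !mulr_ge0 ?nrm_ge0.
    have [n hn] := hZ e e0; have [hx _] := hn x; have [hy _] := hn y.
    have := rdot_le (Z x - Y n x) y; have := rdot_le x (Y n y - Z y).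
    rewrite !(rdotBl, rdotBr) sqrt_iter_adj (nrmB (Z x)).
    have := ler_wpM2l (nrm_ge0 x) hy; have := ler_wpM2r (nrm_ge0 y) hx.
    lra.
  by move=> x y; apply/eqP; rewrite eq_le le_adj (rdotC x) (rdotC _ y) le_adj.
have Zcontr x : nrm (Z x) <= nrm x.
  apply: (le_eps (nrm_ge0 x)) => e e0; have [n hn] := hZ e e0.
  have [hx _] := hn x; have := nrmD (Y n x) (- (Y n x - Z x)).
  rewrite nrmN opprB addrC subrK => /le_trans; apply.
  rewrite (mulrC (nrm x)) lerD// (le_trans (sqrt_iter_nrm n x))//.
  by have /andP[_ b1] := sqrt_bound01 n; rewrite ler_piMl ?nrm_ge0.
have Zfix x : Z x + Z x = x - P x + Z (Z x).
  apply/eqP; rewrite -subr_eq0; apply/eqP.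
  apply: (@nrm_le_eps _ _ (4 * nrm x)) => [|e e0]; first by rewrite mulr_ge0 ?nrm_ge0.
  have [n hn] := hZ e e0; have [hx hx'] := hn x; have [hz _] := hn (Z x).
  have YS : Y n.+1 x + Y n.+1 x = x - P x + Y n (Y n x).
    rewrite [Y n.+1 x](_ : _ = (2^-1)%:C *: (x - P x + Y n (Y n x)))//.
    rewrite -scalerDl -rmorphD (_ : 2^-1 + 2^-1 = 1 :> R); last by field.
    by rewrite rmorph1 scale1r.
  (* Four errors of size at most e |x| each: Y_n and Z are contractions, which handles the last
     two. *)
  have -> : Z x + Z x - (x - P x + Z (Z x)) =
      (Z x - Y n.+1 x) + (Z x - Y n.+1 x) +
      (Y n (Y n x - Z x) + (Y n (Z x) - Z (Z x))).
    rewrite (opB (sqrt_iter_lin n)) subrKA [X in _ = X + _]addrACA -(opprD (Y n.+1 x)) YS.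
    by rewrite !opprD !addrA subrK.
  apply: (le_trans (nrmD _ _)).
  have hb : nrm (Y n (Y n x - Z x)) <= e * nrm x.
    rewrite (le_trans (sqrt_iter_nrm n _))// (le_trans _ hx)//.
    by have /andP[_ b1] := sqrt_bound01 n; rewrite ler_piMl ?nrm_ge0.
  have hz' : e * nrm (Z x) <= e * nrm x by rewrite ler_pM2l.
  have := nrmD (Z x - Y n.+1 x) (Z x - Y n.+1 x).
  have := nrmD (Y n (Y n x - Z x)) (Y n (Z x) - Z (Z x)).
  move: hx'; rewrite (nrmB (Y n.+1 x)); lra.
have Slin : linear (fun x => x - Z x).
  by move=> c x y; rewrite Zlin opprD addrACA -scalerBr.
exists (fun x => x - Z x); split.
- apply/bounded_operatorE; split => //; exists 2 => // x.
  by rewrite (le_trans (nrmD _ _))// nrmN; have := Zcontr x; lra.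
- apply: positive_of_rdot => // [x y|x]; first by rewrite rdotBl rdotBr Zadj.
  rewrite rdotBl rdot_nrm subr_ge0 (le_trans (rdot_le _ _))// expr2.
  by rewrite ler_wpM2r ?nrm_ge0.
apply/funext => x /=; rewrite (opB Zlin) opprB addrCA addrC.
by rewrite -(addrA x) -opprD Zfix opprD addrA subrK subKr.
Qed.

End Contraction.
End SquareRoot.

(** * Square roots, commutation with them, and existence of the polar isometry *)

Section Polar.
Context {R : realType} {H : hilbertType R}.
Implicit Types (x y z : H) (a : R) (S T U C : H -> H).

Lemma comp_linear S T : linear S -> linear T -> linear (S \o T).
Proof. by move=> Sl Tl c x y; rewrite /= Tl Sl. Qed.

(** Dividing P by a norm bound M gives a contraction; its root is then multiplied by the square root
    of M. *)
Lemma sqrt_operatorP P : bounded_operator P -> positive_operator P ->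
  [/\ bounded_operator (sqrt_operator P), positive_operator (sqrt_operator P)
    & forall x, sqrt_operator P (sqrt_operator P x) = P x].
Proof.
move=> /bounded_operatorE[Pl [M M0 hM]] Ppos.
suff [S hS] : exists S,
    [/\ bounded_operator S, positive_operator S & S \o S = P].
  by rewrite /(sqrt_operator P); case: xgetP => [S' _ [? ? SS]|/(_ S)/(_ hS)//];
    split=> // x; have /(congr1 (@^~ x)) := SS.
have Padj := positive_adjoint_pair Pl Ppos; have Prdot := rdot_positive Ppos.
have Mi : 0 < M^-1 by rewrite invr_gt0.
have [c x y|x y|x|x|S [/bounded_operatorE[Sl [N N0 hN]] Spos SS]] :=
    @contraction_sqrt _ _ (fun x => (M^-1)%:C *: P x).
- by rewrite Pl scalerDr !scalerA mulrC.
- by rewrite rdotZl rdotZr Padj.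
- by rewrite rdotZl mulr_ge0// ltW.
- by rewrite nrmZr ?(ltW Mi)// mulrC ler_pdivrMr// mulrC.
pose r : R := Num.sqrt M; have r0 : 0 < r by rewrite sqrtr_gt0.
have Sadj := positive_adjoint_pair Sl Spos.
have rSl : linear (fun x => r%:C *: S x).
  by move=> c x y; rewrite Sl scalerDr !scalerA mulrC.
exists (fun x => r%:C *: S x); split.
- apply/bounded_operatorE; split => //; exists (r * N) => [|x].
    exact: mulr_gt0.
  by rewrite nrmZr ?(ltW r0)// -mulrA ler_pM2l.
- apply: positive_of_rdot => // [x y|x]; first by rewrite rdotZl rdotZr Sadj.
  by rewrite rdotZl mulr_ge0 ?(ltW r0)// rdot_positive.
have rrM : r * (r * M^-1) = 1.
  by rewrite mulrA -expr2 sqr_sqrtr ?(ltW M0)// divff ?gt_eqF.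
apply/funext => x /=; have /(congr1 (@^~ x))/= SSx := SS.
rewrite (opZ Sl) SSx !scalerA -[RHS]scale1r; congr (_ *: _).
by move: rrM => /(congr1 (@real_complex R)); rewrite !rmorphM rmorph1 mulrA.
Qed.

Lemma abs_operatorP T : bounded_operator T ->
  [/\ bounded_operator (abs_operator T), positive_operator (abs_operator T)
    & forall x, abs_operator T (abs_operator T x) = adjoint T (T x)].
Proof.
move=> Tb; have TT := adjointP Tb; have T'b := adjoint_pair_bounded Tb TT.
have /bounded_operatorE[Tl [M M0 hM]] := Tb.
have /bounded_operatorE[T'l [N N0 hN]] := T'b.
have TTl : linear (adjoint T \o T) by exact: comp_linear.
apply: (@sqrt_operatorP (adjoint T \o T)).
  apply/bounded_operatorE; split=> //; exists (N * M) => [|x].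
    exact: mulr_gt0.
  by rewrite (le_trans (hN _))// -mulrA ler_pM2l.
apply: positive_of_rdot => // [x y|x] /=.
  by rewrite -TT (adjoint_pair_sym TT).
by rewrite rdotC -TT rdot_nrm sqr_ge0.
Qed.

(* With [K = S C - C S], [S K = - K S] and hence [(S + M) K = K (M - S)] with
   [M - S] of norm at most [M]; so [M^-n (S + M)^n K x] stays bounded in [n],
   whereas its norm grows at least like [sqrt n * `|S K x|]. *)
Lemma commute_of_commute_sqr S C :
  bounded_operator S -> positive_operator S -> bounded_operator C ->
  C \o (S \o S) = (S \o S) \o C -> C \o S = S \o C.
Proof.
move=> /bounded_operatorE[Sl [M M0 hM]] Spos Cb comm.
have [C' CC'] := adjoint_pair_exists Cb.
have /bounded_operatorE[Cl [N N0 hN]] := Cb.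
have SSC x : S (S (C x)) = C (S (S x)).
  by have /(congr1 (@^~ x)) := comm.
have Sadj := positive_adjoint_pair Sl Spos.
pose K x := S (C x) - C (S x).
have Kl : linear K.
  by move=> c x y; rewrite /K Sl Cl Sl Cl opprD addrACA -scalerBr.
have SK x : S (K x) = - K (S x).
  by rewrite /K (opB Sl) opprB SSC.
have Kb x : nrm (K x) <= 2 * M * N * nrm x.
  rewrite (le_trans (nrmD _ _))// nrmN.
  have h1 := le_trans (hM _) (ler_wpM2l (ltW M0) (hN x)).
  have h2 := le_trans (hN _) (ler_wpM2l (ltW N0) (hM x)).
  by lra.
pose D x := x - (M^-1)%:C *: S x.
have Mi : 0 < M^-1 by rewrite invr_gt0.
have Db x : nrm (D x) <= nrm x.
  have := positive_shift Sl Sadj (rdot_positive Spos) M0 hM x.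
  have -> : M%:C *: x - S x = M%:C *: D x.
    by rewrite /D scalerBr scalerA -rmorphM divff ?gt_eqF// rmorph1 scale1r.
  by rewrite nrmZr ?(ltW M0)// ler_pM2l.
have KD x : K (D x) = K x + (M^-1)%:C *: S (K x).
  by rewrite /D (opB Kl) (opZ Kl) SK scalerN.
have nrmKD x :
    nrm (K x) ^+ 2 + M^-1 ^+ 2 * nrm (S (K x)) ^+ 2 <= nrm (K (D x)) ^+ 2.
  rewrite KD nrm_sqrD nrmZr ?(ltW Mi)// exprMn rdotZr rdotC.
  by rewrite lerDl mulr_ge0// mulr_ge0 ?(ltW Mi)// rdot_positive.
have nrmSKD x : nrm (S (K x)) <= nrm (S (K (D x))).
  rewrite KD (opD Sl) (opZ Sl) -ler_sqr ?nnegrE ?nrm_ge0// nrm_sqrD.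
  rewrite -addrA lerDl addr_ge0 ?sqr_ge0// mulr_ge0// rdotZr rdotC.
  by rewrite mulr_ge0 ?(ltW Mi)// rdot_positive.
have SK0 x : S (K x) = 0.
  have grow n : nrm (K x) ^+ 2 + n%:R * (M^-1 ^+ 2 * nrm (S (K x)) ^+ 2)
        <= nrm (K (iter n D x)) ^+ 2 /\ nrm (S (K x)) <= nrm (S (K (iter n D x)))
        /\ nrm (iter n D x) <= nrm x.
    elim: n => [|n [h1 [h2 h3]]]; first by rewrite mul0r addr0.
    split; last by split; [exact: le_trans h2 (nrmSKD _) | exact: le_trans (Db _) h3].
    apply: le_trans (nrmKD _) => /=.
    have : nrm (S (K x)) ^+ 2 <= nrm (S (K (iter n D x))) ^+ 2.
      by rewrite ler_sqr ?nnegrE ?nrm_ge0.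
    rewrite -(ler_pM2l (exprn_gt0 2 Mi)) -natr1; lra.
  apply: nrm_eq0; apply/eqP/negPn/negP => SK0.
  pose q := M^-1 ^+ 2 * nrm (S (K x)) ^+ 2; pose B := (2 * M * N * nrm x) ^+ 2.
  have q0 : 0 < q by rewrite mulr_gt0 ?exprn_gt0// lt_def SK0 nrm_ge0.
  have [n lt_n] : exists n : nat, B / q < n%:R.
    by exists (Num.bound (B / q)); rewrite archi_boundP// divr_ge0 ?sqr_ge0 ?ltW.
  have [h1 [_ h3]] := grow n.
  have : nrm (K (iter n D x)) ^+ 2 <= B.
    have MN0 : 0 <= 2 * M * N by rewrite !mulr_ge0 ?(ltW M0) ?(ltW N0).
    rewrite ler_sqr ?nnegrE ?nrm_ge0 ?(mulr_ge0 MN0) ?nrm_ge0//.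
    by apply: le_trans (Kb _) _; exact: ler_wpM2l.
  move: lt_n; rewrite ltr_pdivrMr// => lt_n le_B.
  have := sqr_ge0 (nrm (K x)); rewrite -/q in h1; lra.
(* The adjoint of C also commutes with S^2, so it preserves the kernel of S. As S K = 0, this kills
   both terms of |K x|^2 = (K x, S C x) - (K x, C S x). *)
have ker_SC' y : S y = 0 -> S (C' y) = 0.
  move=> Sy0; apply: nrm_eq0; apply/eqP; rewrite -sqrf_eq0 -rdot_nrm.
  by rewrite Sadj (adjoint_pair_sym CC') -SSC -!Sadj Sy0 (op0 Sl) rdot0l.
apply/funext => x /=; apply/esym/eqP; rewrite -subr_eq0 -/(K x).
apply/eqP/nrm_eq0/eqP; rewrite -sqrf_eq0 -rdot_nrm {2}/K rdotBr -Sadj SK0 rdot0l.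
by rewrite -(adjoint_pair_sym CC') -Sadj ker_SC'// rdot0l subrr.
Qed.

Lemma rdot_closure0 (V : set H) p y :
  (forall e : R, 0 < e -> exists2 v, V v & nrm (p - v) <= e) ->
  (forall v, V v -> rdot y v = 0) -> rdot y p = 0.
Proof.
move=> cl_p orth; have le0 s : rdot (s%:C *: y) p <= 0.
  apply: (le_eps (nrm_ge0 (s%:C *: y))) => e e0.
  have [v Vv le_v] := cl_p e e0.
  have := rdot_le (s%:C *: y) (p - v).
  rewrite rdotBr (rdotZl s y v) orth// mulr0 subr0 => /le_trans; apply.
  by rewrite add0r ler_wpM2l ?nrm_ge0.
have := le0 1; have := le0 (-1); rewrite !rdotZl => h1 h2.
by apply/eqP; rewrite eq_le; apply/andP; split; lra.
Qed.

(** Since |T z| = |M z|, the assignment M z |-> T z is isometric. U extends it to the closure of the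
    range of M and is 0 on the orthogonal complement. *)
Lemma polar_isometryP T : bounded_operator T ->
  let U := polar_isometry T in
  [/\ bounded_operator U, partial_isometry U, null_space U = null_space T
    & T = U \o abs_operator T].
Proof.
move=> Tb; have [Mb Mpos MM] := abs_operatorP Tb.
set M := abs_operator T in Mb Mpos MM *.
suff [U hU] : exists U, [/\ bounded_operator U, partial_isometry U,
    null_space U = null_space T & T = U \o M].
  by rewrite /polar_isometry; case: xgetP => [U' _ //|/(_ U)/(_ hU)].
have Tl : linear T by case: Tb.
have Ml : linear M by case: Mb.
have Madj := positive_adjoint_pair Ml Mpos.
have nrmTM z : nrm (T z) = nrm (M z).
  apply/eqP; rewrite -(eqrXn2 (n:=2))// ?nrm_ge0// -!rdot_nrm.
  by rewrite (adjointP Tb) -MM Madj.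
have TM0 z : M z = 0 -> T z = 0.
  by move=> Mz; apply: nrm_eq0; rewrite nrmTM Mz nrm0.
have orthM y : (forall z, rdot y (M z) = 0) -> M y = 0.
  by move=> h; apply: rdotT_eq0 => z; rewrite Madj.
(* [(p, u)] is in the closure of the graph of [M z |-> T z]. *)
pose cl p u := forall e : R, 0 < e ->
  exists2 z, nrm (M z - p) <= e & nrm (T z - u) <= e.
have near y z : nrm y <= nrm z + nrm (y - z).
  by have := nrmD z (y - z); rewrite [z + _]addrC subrK.
have cl_nrm p u : cl p u -> nrm u = nrm p.
  move=> h; apply/eqP; rewrite eq_le; apply/andP; split;
    apply: (@le_eps _ 2) => // e e0; have [z h1 h2] := h e e0.
    by have := near u (T z); have := near (M z) p; rewrite nrmTM (nrmB u); lra.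
  by have := near p (M z); have := near (T z) u; rewrite nrmTM (nrmB p); lra.
have clD c p u q v : cl p u -> cl q v -> cl (c *: p + q) (c *: u + v).
  move=> h1 h2 e e0.
  pose k : R := complex.Re `|c|.
  have k0 : 0 <= k by rewrite -ler0c RRe_real ?normr_real ?normr_ge0.
  have k1 : 0 < k + 1 by rewrite ltr_wpDl.
  have d0 : 0 < e / (k + 1) by rewrite divr_gt0.
  have [z z1 z2] := h1 _ d0; have [w w1 w2] := h2 _ d0.
  have de : k * (e / (k + 1)) + e / (k + 1) = e by field; rewrite gt_eqF.
  exists (c *: z + w); rewrite ?Ml ?Tl opprD addrACA -scalerBr -de;
    by rewrite (le_trans (nrmD _ _))// nrmZ lerD// ler_wpM2l.
(* The graph of U: p is the component of x in the closure of the range of M. [GD] and [Gnrm] make it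
   single-valued and linear. *)
pose G x u := exists2 p, cl p u & forall z, rdot (x - p) (M z) = 0.
have GD c x u y v : G x u -> G y v -> G (c *: x + y) (c *: u + v).
  move=> [p cl1 o1] [q cl2 o2]; exists (c *: p + q); first exact: clD.
  move=> z; rewrite opprD addrACA -scalerBr rdotDl o2 addr0.
  by rewrite rdot_conj -(opZ Ml) o1.
have cl_orth p u y : cl p u -> (forall z, rdot y (M z) = 0) -> rdot y p = 0.
  move=> clp o; apply: (rdot_closure0 (V := range M)) => [e e0|_ [z _ <-] //].
  by have [z le_z _] := clp e e0; exists (M z); [exists z|rewrite nrmB].
have Gnrm x u : G x u -> nrm u <= nrm x.
  move=> [p clp o]; rewrite (cl_nrm _ _ clp).
  have := cl_orth _ _ _ clp o; have := nrm_sqrD (x - p) p; rewrite subrK => xE o'.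
  by rewrite -ler_sqr ?nnegrE ?nrm_ge0// xE o'; have := sqr_ge0 (nrm (x - p)); lra.
have Gexists x : exists u, G x u.
  have [||a _ [z _ <-]|p clp o] := @orth_projection _ _ (range M) x.
  - by exists 0 => //; exact: op0.
  - by move=> _ _ [z _ <-] [w _ <-]; exists (z + w) => //; exact: opD.
  - by exists (a%:C *: z) => //; exact: opZ.
  pose F e := [set u | exists2 z, nrm (M z - p) <= e & u = T z].
  have [e e' ee' _ [z le_z ->]|e e0|e e0|u hu] := @shrinking_limit _ _ F.
  - by exists z => //; exact: le_trans ee'.
  - have [_ [z _ <-] le_z] := clp e e0.
    by exists (T z), z => //; rewrite nrmB.
  - exists (e / 2) => [|_ _ [z le_z ->] [w le_w ->]]; first exact: divr_gt0.
    rewrite -(opB Tl) nrmTM (opB Ml) (le_trans (nrm_triangle p _ _))//.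
    by rewrite (nrmB p); lra.
  exists u; exists p => [e e0|z]; last by apply: o; exists z.
  by have [_ [z le_z ->] le_u] := hu e e0; exists z.
have /choice[U GU] := Gexists.
have Guniq x u v : G x u -> G x v -> u = v.
  move=> Gu Gv; apply/eqP; rewrite -subr_eq0; apply/eqP/nrm_eq0/eqP.
  rewrite eq_le nrm_ge0 andbT -(@nrm0 _ H) -[in leRHS](subrr x).
  by apply: Gnrm; have := GD (-1) _ _ _ _ Gv Gu; rewrite !scaleN1r ![- _ + _]addrC.
have Ul : linear U by move=> c x y; apply: Guniq (GU _) _; exact: GD.
have UM z : U (M z) = T z.
  apply: Guniq (GU _) _; exists (M z) => [e e0|w]; last by rewrite subrr rdot0l.
  by exists z; rewrite subrr nrm0 ltW.
have null x : U x = 0 <-> T x = 0.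
  have [p clp o] := GU x; split => [Ux0|Tx0].
    apply/TM0/orthM => z; have p0 : p = 0.
      by apply: nrm_eq0; rewrite -(cl_nrm _ _ clp) Ux0 nrm0.
    by have := o z; rewrite p0 subr0.
  have Mx0 : M x = 0 by apply: nrm_eq0; rewrite -nrmTM Tx0 nrm0.
  have xp : rdot x p = 0.
    by apply: cl_orth clp _ => z; rewrite -Madj Mx0 rdot0l.
  apply: nrm_eq0; rewrite (cl_nrm _ _ clp); apply/eqP; rewrite -sqrf_eq0.
  have := cl_orth _ _ _ clp o; rewrite rdotBl xp sub0r rdot_nrm => /eqP.
  by rewrite oppr_eq0.
exists U; split.
- apply/bounded_operatorE; split=> //; exists 1 => // x; rewrite mul1r.
  exact: Gnrm.
- move=> x orth; have [p clp o] := GU x.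
  (* x - p is orthogonal to the range of M, hence in the kernel of U, to which x is orthogonal by
     assumption; so x = p, where U is isometric. *)
  have xp : U (x - p) = 0.
    by apply/null/TM0/orthM.
  have xxp : rdot x (x - p) = 0 by rewrite /rdot orth.
  have := cl_orth _ _ _ clp o; rewrite rdotC => pxp.
  have xp0 : x - p = 0.
    by apply: nrm_eq0; apply/eqP; rewrite -sqrf_eq0 -rdot_nrm rdotBl xxp pxp subrr.
  rewrite !nrmE (cl_nrm _ _ clp); congr (nrm _)%:C.
  by apply/esym/eqP; rewrite -subr_eq0 xp0.
- by apply/seteqP; split=> x /null.
by apply/funext => z /=; rewrite UM.
Qed.

End Polar.

(** * Polar decomposition and normality *)

Section PolarDecomposition.
Context {R : realType} {H : hilbertType R}.
Variables (T : H -> H) (Tb : bounded_operator T).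
Implicit Types x y z : H.

Let T' : H -> H := adjoint T.
Let M : H -> H := abs_operator T.
Let A : H -> H := sqrt_operator M.
Let U : H -> H := polar_isometry T.

Let Tl : linear T := proj1 Tb.
Let TT' : adjoint_pair T T' := adjointP Tb.
Let Mb : bounded_operator M. Proof. by have [] := abs_operatorP Tb. Qed.
Let Mpos : positive_operator M. Proof. by have [] := abs_operatorP Tb. Qed.
Let MM x : M (M x) = T' (T x). Proof. by have [_ _] := abs_operatorP Tb. Qed.
Let Ab : bounded_operator A. Proof. by have [] := sqrt_operatorP Mb Mpos. Qed.
Let Apos : positive_operator A. Proof. by have [] := sqrt_operatorP Mb Mpos. Qed.
Let AA x : A (A x) = M x. Proof. by have [_ _] := sqrt_operatorP Mb Mpos. Qed.
Let Ml : linear M := proj1 Mb.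
Let Al : linear A := proj1 Ab.
Let Madj : adjoint_pair M M := positive_adjoint_pair Ml Mpos.
Let Aadj : adjoint_pair A A := positive_adjoint_pair Al Apos.
Let Ub : bounded_operator U. Proof. by have [] := polar_isometryP Tb. Qed.
Let Uiso : partial_isometry U. Proof. by have [] := polar_isometryP Tb. Qed.
Let Unull : null_space U = null_space T.
Proof. by have [] := polar_isometryP Tb. Qed.
Let UM x : U (M x) = T x.
Proof. by have [_ _ _ /(congr1 (@^~ x))] := polar_isometryP Tb. Qed.
Let Ul : linear U := proj1 Ub.
Let U' : H -> H := adjoint U.
Let UU' : adjoint_pair U U' := adjointP Ub.
Let U'l : linear U' := adjoint_pair_linear Ul UU'.

Lemma null_polar x : U x = 0 <-> T x = 0.
Proof.
by have := congr1 (@^~ x) Unull; rewrite /null_space/= => h;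
  split=> hx; [rewrite -h|rewrite h].
Qed.

Lemma null_abs x : M x = 0 <-> T x = 0.
Proof.
have TM : nrm (T x) = nrm (M x).
  by apply/eqP; rewrite -(eqrXn2 (n:=2))// ?nrm_ge0// -!rdot_nrm TT' -MM Madj.
by split=> x0; apply: nrm_eq0; [rewrite TM|rewrite -TM]; rewrite x0 nrm0.
Qed.

(** The weights at 1/2 are 1/4, 1/4 and 1/2; cancelling half of the Aluthge transform and
    multiplying by 4 leaves an identity without scalars. *)
Lemma power_mean_aluthgeE :
  power_mean 2^-1 T = aluthge T <->
  forall x, T x + M (U x) = A (U (A x)) + A (U (A x)).
Proof.
have half : (1 - 2^-1 : R) = 2^-1 by field.
have quarter : (2^-1 ^+ 2 : R) = 4^-1 by field.
have half' : (2 * 2^-1 * (1 - 2^-1) : R) = 2^-1 by field.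
have pmE x : power_mean 2^-1 T x =
    (4^-1)%:C *: (T x + M (U x)) + (2^-1)%:C *: A (U (A x)).
  by rewrite /power_mean half' half quarter scalerDr.
have four x : x = (4^-1)%:C *: (x + x) + (2^-1)%:C *: x.
  rewrite scalerDr -!scalerDl -!rmorphD -[LHS]scale1r; congr (_ *: _).
  by rewrite -(rmorph1 (@real_complex R)); congr (_ %:C); field.
split=> [h x|h].
  have := congr1 (@^~ x) h; rewrite pmE [aluthge T x](_ : _ = A (U (A x)))//.
  rewrite {2}(four (A (U (A x)))) => /addIr.
  by apply: scalerI; rewrite eq_complex/= invr_eq0 pnatr_eq0.
by apply/funext => x; rewrite pmE h -four.
Qed.

Lemma normal_of_aluthge :
  null_space T' `<=` null_space T ->
  (forall x, T x + M (U x) = A (U (A x)) + A (U (A x))) -> normal_operator T.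
Proof.
move=> nullT eqA.
have T'E y : T' y = M (U' y).
  apply/eqP; rewrite -subr_eq0; apply/eqP/rdotT_eq0 => x.
  by rewrite rdotC rdotBr -TT' -Madj -UU' UM subrr.
have Unrm x : (forall y, U y = 0 -> rdot x y = 0) -> nrm (U x) = nrm x.
  move=> orth; rewrite /nrm Uiso// => y Uy.
  apply/eqP; rewrite eq_complex/= -/(rdot x y) orth// eqxx/=.
  by rewrite Im_inner rdot_conj orth// (opZ Ul) Uy scaler0.
have U0 : U 0 = 0 := op0 Ul.
(* U^*U is the projection onto the orthogonal complement of the kernel of U, and that kernel is also
   the kernel of M and of A. *)
have AU'U z : A (U' (U z)) = A z.
  have [||a v Uv|p clp orth] := @orth_projection _ _ (null_space U) z.
  - exact: U0.
  - by move=> u v Uu Uv; rewrite /null_space/= (opD Ul) Uu Uv addr0.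
  - by rewrite /null_space/= (opZ Ul) Uv scaler0.
  have Up : U p = 0.
    have /bounded_operatorE[_ [N N0 hN]] := Ub.
    apply: (nrm_le_eps (ltW N0)) => e e0; have [v Uv le_v] := clp _ e0.
    by rewrite -[U p]subr0 -Uv -(opB Ul) (le_trans (hN _))// ler_pM2l.
  have Uz : U z = U (z - p) by rewrite (opB Ul) Up subr0.
  (* Polarisation turns norm preservation off the kernel into preservation of the inner product. *)
  have isoD x y : (forall v, U v = 0 -> rdot x v = 0) ->
      (forall v, U v = 0 -> rdot y v = 0) -> rdot (U x) (U y) = rdot x y.
    move=> ox oy; have : nrm (U (x + y)) = nrm (x + y).
      by apply: Unrm => v Uv; rewrite rdotDl ox// oy// addr0.
    move=> /(congr1 (fun t => t ^+ 2)); rewrite (opD Ul) !nrm_sqrD !Unrm//.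
    by move=> ?; lra.
  have M0 : M (U' (U z) - z) = 0.
    apply: rdotT_eq0 => w; rewrite Madj rdotBl (adjoint_pair_sym UU') Uz isoD//.
    - rewrite rdotBl -(Madj p).
      have -> : M p = 0 by apply/null_abs/null_polar.
      by rewrite rdot0l subr0 subrr.
    - move=> v /null_polar/null_abs Mv.
      by rewrite Madj Mv rdotC rdot0l.
  apply/eqP; rewrite -subr_eq0 -(opB Al); apply/eqP/nrm_eq0/eqP.
  by rewrite -sqrf_eq0 -rdot_nrm Aadj AA M0 rdotC rdot0l.
pose B x := U (A (U' x)).
(* T^* = M U^* vanishes on U U^* z - z because M U^*U = M; the inclusion of null spaces passes this
   on to T, then to M and A. *)
have AUU' z : A (U (U' z)) = A z.
  have : T (U (U' z) - z) = 0.
    by apply: nullT; rewrite /null_space/= (opB (adjoint_pair_linear Tl TT')) !T'E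
      -AA AU'U AA subrr.
  move=> /null_abs; rewrite -AA => h.
  apply/eqP; rewrite -subr_eq0 -(opB Al); apply/eqP/nrm_eq0/eqP.
  by rewrite -sqrf_eq0 -rdot_nrm Aadj h rdotC rdot0l.
have Bl : linear B by do 2?apply: comp_linear.
have BB z : B (B z) = U (M (U' z)) by rewrite /B AU'U AA.
have Badj : adjoint_pair B B.
  by move=> x y; rewrite /B UU' Aadj (adjoint_pair_sym UU').
have AB x : A (A x) + B (B x) = A (B x) + A (B x).
  have := eqA (U' x); rewrite /B -UM -[M (U (U' x))]AA AUU' => <-.
  by rewrite AU'U !AA addrC.
have eqAB : A = B.
  apply/funext => x; apply/eqP; rewrite -subr_eq0; apply/eqP/nrm_eq0/eqP.
  rewrite -sqrf_eq0 nrm_sqrB -!rdot_nrm Aadj (Badj x).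
  have := congr1 (rdot x) (AB x); rewrite !rdotDr -(Aadj x (B x)) => h.
  by apply/eqP; lra.
apply/funext => x /=; rewrite -/T' -MM -UM T'E.
(* This is A^2 = B^2; applied twice, it turns M^2 into U M^2 U^* = T T^*. *)
have MB z : M z = U (M (U' z)) by rewrite -AA {1}eqAB eqAB BB.
by rewrite MB (MB x) -[M (U' (U _))]AA AU'U AA.
Qed.

Lemma aluthge_of_normal : normal_operator T ->
  null_space T' `<=` null_space T /\
  forall x, T x + M (U x) = A (U (A x)) + A (U (A x)).
Proof.
move=> normT; have T'T x : T' (T x) = T (T' x) by exact: (congr1 (@^~ x) normT).
split=> [x T'x0|].
  apply: nrm_eq0; apply/eqP; rewrite -sqrf_eq0 -rdot_nrm TT' T'T T'x0.
  by rewrite (op0 Tl) rdotC rdot0l.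
have TM x : T (M x) = M (T x).
  (* M^2 = T^*T, and normality moves T across T^*. *)
  have comm : T \o (M \o M) = (M \o M) \o T.
    by apply/funext => y /=; rewrite !MM -T'T.
  exact: (congr1 (@^~ x) (commute_of_commute_sqr Mb Mpos Tb comm)).
(* [K = U M - M U] vanishes on the range of [M], so the range of its adjoint
   is contained in the kernel of [M], on which [K] vanishes as well. *)
have UMC x : U (M x) = M (U x).
  pose K' y := M (U' y) - U' (M y).
  have KK' y z : rdot (U (M y) - M (U y)) z = rdot y (K' z).
    by rewrite rdotBl UU' !Madj UU' -rdotBr.
  have MK' z : M (K' z) = 0.
    apply: rdotT_eq0 => y.
    by rewrite Madj rdotC -KK' !UM TM subrr rdot0l.
  have K'0 z : K' z = 0.
    apply: nrm_eq0; apply/eqP; rewrite -sqrf_eq0 -rdot_nrm -KK' MK'.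
    have -> : U (K' z) = 0 by apply/null_polar/null_abs.
    by rewrite (op0 Ul) (op0 Ml) subrr rdot0l.
  apply/eqP; rewrite -subr_eq0; apply/eqP/rdotT_eq0 => z.
  by rewrite KK' K'0 rdotC rdot0l.
have UA x : U (A x) = A (U x).
  have comm : U \o (A \o A) = (A \o A) \o U.
    by apply/funext => y /=; rewrite !AA UMC.
  exact: (congr1 (@^~ x) (commute_of_commute_sqr Ab Apos Ub comm)).
by move=> x; rewrite UA AA -UMC UM.
Qed.

End PolarDecomposition.

Theorem corollary3p7 (R : realType) (H : hilbertType R) (T : H -> H)
    (T_bounded : bounded_operator T) (T_binormal : binormal_operator T) :
  normal_operator T <->
  null_space (adjoint T) `<=` null_space T /\
  power_mean 2^-1 T = aluthge T.
Proof.
split=> [/(aluthge_of_normal T_bounded)[nullT eqA]|[nullT]].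
  by split=> //; apply/power_mean_aluthgeE.
by move=> /power_mean_aluthgeE; exact: normal_of_aluthge.
Qed.
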